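(* Let $n\ge3$ and $2\le p\le n-1$ be integers and $q=n-p$. For every $\kappa\in\mathcal P_p$, every $i\in\{1,\dots,n\}$, and every $t\in\mathbb{R}^n$ with $\sum_jS_jt_j=0$, $$Q_i\ge\frac{2S_i}{H+q|\kappa_i|}\Big(\sum_jt_j\Big)^2 .$$ Consequently, for every $\theta>0$, every $\kappa\in\mathcal P_p$, every $i\in\{1,\dots,n\}$, and every $t\in\mathbb{R}^n$ with $\sum_jS_jt_j=0$, $$|\kappa_i|\le\frac{\theta H}{q}\quad\Longrightarrow\quad Q_i\ge\frac{S_i}{H}\,\frac{2}{1+\theta}\Big(\sum_jt_j\Big)^2 .$$ Taking $\theta=1/3$ gives the coefficient $3/2$, that is, $Q_i\ge\frac32\frac{S_i}{H}\big(\sum_jt_j\big)^2$, whenever $|\kappa_i|\le H/(3q)$.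
   Context: All indices $i,j$ range over $\{1,\dots,n\}$. $\mathcal I_p=\{I\subset\{1,\dots,n\}:|I|=p\}$; for $\kappa\in\mathbb{R}^n$, $\lambda_I=\sum_{i\in I}\kappa_i$ and $H=\sum_i\kappa_i$; $\mathcal P_p=\{\kappa\in\mathbb{R}^n:\lambda_I>0\text{ for all }I\in\mathcal I_p\}$. For $\kappa\in\mathcal P_p$, $S_i=\sum_{I\in\mathcal I_p,\,I\ni i}\lambda_I^{-1}$. For $\kappa\in\mathcal P_p$, $i\in\{1,\dots,n\}$ and $t=(t_1,\dots,t_n)\in\mathbb{R}^n$, $$Q_i=Q_i(\kappa,t)=2\sum_{j\ne i}\ \sum_{\substack{K\subset\{1,\dots,n\}\setminus\{i,j\}\\|K|=p-1}}\frac{t_j^2}{\lambda_{K\cup\{i\}}\lambda_{K\cup\{j\}}}+\sum_{I\in\mathcal I_p}\lambda_I^{-2}\Big(\sum_{j\in I}t_j\Big)^2 .$$ *)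

(* Defs.v *)
From mathcomp Require Import all_boot all_order all_algebra.
From mathcomp Require Import reals.

Set Implicit Arguments.
Unset Strict Implicit.
Unset Printing Implicit Defensive.

Import Order.TTheory GRing.Theory Num.Theory.
Local Open Scope ring_scope.

Section PSums.
Variables (R : realType) (n p : nat).
Implicit Types (kappa t : 'rV[R]_n) (i j : 'I_n) (I K : {set 'I_n}).

Definition psets : {set {set 'I_n}} := [set I : {set 'I_n} | #|I| == p].

Definition lambda kappa I : R := \sum_(i in I) kappa 0 i.

Definition Hsum kappa : R := \sum_i kappa 0 i.

Definition pcone kappa : Prop := forall I, I \in psets -> 0 < lambda kappa I.

Definition Ssum kappa i : R :=
  \sum_(I in psets | i \in I) (lambda kappa I)^-1.

Definition Qform kappa i t : R :=
  2 * (\sum_(j | j != i)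
         \sum_(K : {set 'I_n} | (K \subset ~: [set i; j]) && (#|K| == p - 1)%N)
            (t 0 j) ^+ 2 / (lambda kappa (i |: K) * lambda kappa (j |: K)))
  + \sum_(I in psets) (lambda kappa I) ^- 2 * (\sum_(j in I) t 0 j) ^+ 2.

End PSums.

(* Main.v *)
Require Import Defs.
From mathcomp Require Import all_boot all_order all_algebra.
From mathcomp Require Import reals.
From mathcomp Require Import ring lra.

Set Implicit Arguments.
Unset Strict Implicit.
Unset Printing Implicit Defensive.

Import Order.TTheory GRing.Theory Num.Theory.
Local Open Scope ring_scope.

(** Write [a] for the [lambda] of [i |: J :\ j] and [L] for that of [J], where
    [i \notin J] and [j \in J].  Exchanging one index of a [p]-set turns the
    constraint into [S_i * T = \sum_J \sum_(j in J) (1/a - 1/L) * t_j], with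
    [T] the sum of the [t_j].  For each [J], the part of [Q_i] attached to [J]
    dominates [2 * mu * l_J - mu^2 * C_J], where [l_J] is the inner sum, by a sum
    of squares; the [p]-sets containing [i] only contribute nonnegative terms.
    The costs [C_J] add up to at most [S_i * D / 2] with [D = H + q * |kappa_i|],
    and [mu = 2 * T / D] gives the bound. *)

(** * Inequalities attached to a single exchange set *)

(** Cauchy-Schwarz in explicit form: the difference of the two sides is a weighted sum of the
    squares of [1 - c * a j], with [c] the inverse of the mean of [a]. *)
Lemma le_sqr_card_sum_inv (R : realFieldType) (T : finType) (J : {set T})
    (a : T -> R) (s := \sum_(j in J) a j) :
  (forall j, j \in J -> 0 < a j) -> 0 < s ->
  #|J|%:R ^+ 2 / s <= \sum_(j in J) (a j)^-1.
Proof.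
move=> a_gt0 s_gt0; pose c := #|J|%:R / s.
rewrite -subr_ge0.
suff -> : \sum_(j in J) (a j)^-1 - #|J|%:R ^+ 2 / s
    = \sum_(j in J) (a j)^-1 * (1 - c * a j) ^+ 2.
  by apply: sumr_ge0 => j /a_gt0 aj; rewrite mulr_ge0 ?sqr_ge0 ?invr_ge0 ?ltW.
rewrite [RHS](eq_bigr (fun j => (a j)^-1 - 2 * c + c ^+ 2 * a j)); last first.
  by move=> j /a_gt0 aj; field; rewrite gt_eqF.
rewrite big_split sumrB sumr_const -mulr_sumr /= -/s -mulr_natr /c.
by field; rewrite gt_eqF.
Qed.

(** In the application [A * L] is the sum of the [a j] and [B] the sum of their inverses. For
    [k <= 0] the right side vanishes and [A <= p]. For [k > 0], replacing [B] by its lower bound and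
    eliminating [k] leaves a rational inequality in [A > p - 1]. *)
Lemma sub_sqr_div_le (R : realFieldType) (p A L k B : R) :
  2 <= p -> 0 < A -> 0 < L -> 0 <= B ->
  A * L = (p - 1) * L + p * k -> p ^+ 2 / (A * L) <= B ->
  p + 2 - (p + 2) ^+ 2 / (A + 2) <= (k + `|k|) * B.
Proof.
move=> p2 A0 L0 B0 AL pB.
have A2 : 0 < A + 2 by lra.
have [k0|k0] := leP k 0.
  rewrite ler0_norm // subrr mul0r subr_le0 ler_pdivlMr // expr2 ler_pM2l; last by lra.
  have : A * L <= p * L by nra.
  by rewrite ler_pM2r //; lra.
rewrite gtr0_norm //; have p0 : 0 < p by lra.
have kE : k = (A - p + 1) * L / p.
  apply: (mulfI (lt0r_neq0 p0)); rewrite mulrC [RHS]mulrC divfK ?gt_eqF //.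
  by rewrite mulrC; lra.
have AgtP : p - 1 < A.
  by rewrite -(ltr_pM2r L0); nra.
apply: (@le_trans _ _ ((k + k) * (p ^+ 2 / (A * L)))); last first.
  by rewrite ler_pM2l //; lra.
have -> : (k + k) * (p ^+ 2 / (A * L)) = 2 * p * (A - p + 1) / A.
  by rewrite kE; field; rewrite !gt_eqF.
rewrite -subr_ge0.
have -> : 2 * p * (A - p + 1) / A - (p + 2 - (p + 2) ^+ 2 / (A + 2))
   = ((p - 2) * A ^+ 2 + A * (8 * p - p ^+ 2) - 4 * p * (p - 1)) / (A * (A + 2)).
  by field; rewrite !gt_eqF.
rewrite divr_ge0 ?mulr_ge0 ?(ltW A0) ?(ltW A2) //.
(* Expansion of the numerator around [A = p - 1]; each coefficient is nonnegative because
   [2 <= p]. *)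
have -> : (p - 2) * A ^+ 2 + A * (8 * p - p ^+ 2) - 4 * p * (p - 1)
  = (p - 2) * (A - (p - 1)) ^+ 2
    + (A - (p - 1)) * (p ^+ 2 + 2 * p + 4) + (p - 1) * (p + 2) by ring.
rewrite !addr_ge0 // ?mulr_ge0 ?sqr_ge0 //; try lra.
by rewrite !addr_ge0 ?sqr_ge0 //; lra.
Qed.

(** Here [k] plays the role of [kappa 0 i]. The right side minus the left is a sum of squares plus
    [mu ^+ 2 / 2] times the slack in [sub_sqr_div_le]. *)
Lemma exchange_quadratic_bound (R : realFieldType) (T : finType) (J : {set T})
    (a t : T -> R) (L k mu : R) :
  (2 <= #|J|)%N -> 0 < L -> (forall j, j \in J -> 0 < a j) ->
  \sum_(j in J) a j = (#|J|%:R - 1) * L + #|J|%:R * k ->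
  2 * mu * (\sum_(j in J) ((a j)^-1 - L^-1) * t j)
    - mu ^+ 2 / 2 * (\sum_(j in J) (L / a j - 1 + (k + `|k|) / a j))
  <= 2 * (\sum_(j in J) t j ^+ 2 / (a j * L)) + L ^- 2 * (\sum_(j in J) t j) ^+ 2.
Proof.
move=> J2 L0 a_gt0 sumE; set p : R := #|J|%:R.
have p2 : 2 <= p by rewrite ler_nat.
pose s := \sum_(j in J) a j.
have s0 : 0 < s.
  rewrite /s; have /card_gt0P [j0 j0J] : (0 < #|J|)%N by apply: leq_trans J2.
  rewrite (bigD1 j0) //= ltr_pwDl ?a_gt0 // sumr_ge0 // => j /andP[jJ _].
  by rewrite ltW ?a_gt0.
pose B := \sum_(j in J) (a j)^-1.
have B0 : 0 <= B by apply: sumr_ge0 => j /a_gt0 aj; rewrite invr_ge0 ltW.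
pose A := s / L.
have A0 : 0 < A by rewrite divr_gt0.
have A2 : 0 < A + 2 by lra.
have AL : A * L = s by rewrite divfK ?gt_eqF.
(* This [x] minimizes [- 2 * x * p + x ^+ 2 * A + 2 * (x - 1) ^+ 2]. *)
pose x := (p + 2) / (A + 2).
pose tJ := \sum_(j in J) t j.
pose ta := \sum_(j in J) t j / a j.
have local : p + 2 - (p + 2) ^+ 2 / (A + 2) <= (k + `|k|) * B.
  apply: (sub_sqr_div_le (L := L)) => //; rewrite AL //.
  exact: le_sqr_card_sum_inv.
(* For every [x] the parts of these squares linear in [t] add up to [- 2 * mu] times the linear form
   of the statement, since the terms in [x * tJ] cancel. So [x] is free to minimize the constant
   part. *)
have sos : 0 <= \sum_(j in J) 2 / (a j * L) * (t j - mu * (L - x * a j) / 2) ^+ 2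
    + (tJ / L - mu * (x - 1)) ^+ 2.
  rewrite addr_ge0 ?sqr_ge0 // sumr_ge0 // => j /a_gt0 aj.
  by rewrite mulr_ge0 ?sqr_ge0 // divr_ge0 // mulr_ge0 ?ltW.
have sosE : \sum_(j in J) 2 / (a j * L) * (t j - mu * (L - x * a j) / 2) ^+ 2
  = 2 * (\sum_(j in J) t j ^+ 2 / (a j * L)) - 2 * mu * ta + 2 * mu * x / L * tJ
    + mu ^+ 2 / 2 * (L * B - 2 * x * p + x ^+ 2 * A).
  transitivity (\sum_(j in J) (2 * (t j ^+ 2 / (a j * L)) - 2 * mu * (t j / a j)
     + 2 * mu * x / L * t j
     + (mu ^+ 2 / 2 * L * (a j)^-1 - mu ^+ 2 * x + mu ^+ 2 / 2 * x ^+ 2 / L * a j))).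
    by apply: eq_bigr => j /a_gt0 aj; field; rewrite !gt_eqF.
  rewrite !(big_split, sumrN) /= sumr_const -!mulr_sumr -/ta -/tJ -/B -/s.
  by rewrite -mulr_natr -/p -AL; field; rewrite gt_eqF.
have linE : \sum_(j in J) ((a j)^-1 - L^-1) * t j = ta - tJ / L.
  rewrite /ta /tJ mulr_suml -sumrB; apply: eq_bigr => j _; ring.
have costE : \sum_(j in J) (L / a j - 1 + (k + `|k|) / a j)
    = L * B - p + (k + `|k|) * B.
  by rewrite !(big_split, sumrN) /= sumr_const -!mulr_sumr.
rewrite linE costE -/tJ -subr_ge0; apply: le_trans sos _; rewrite sosE -subr_ge0.
set X := \sum_(j in J) _.
set Z := (k + `|k|) * B in local *.
(* Once the squares are removed, nothing depends on [t]. *)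
have -> : 2 * X + L ^- 2 * tJ ^+ 2 -
   (2 * mu * (ta - tJ / L) - mu ^+ 2 / 2 * (L * B - p + Z)) -
   (2 * X - 2 * mu * ta + 2 * mu * x / L * tJ +
    mu ^+ 2 / 2 * (L * B - 2 * x * p + x ^+ 2 * A) + (tJ / L - mu * (x - 1)) ^+ 2)
  = mu ^+ 2 / 2 * (Z - (p + 2 - (p + 2) ^+ 2 / (A + 2))).
  by rewrite /x; field; rewrite !gt_eqF.
by rewrite mulr_ge0 ?divr_ge0 ?sqr_ge0 // subr_ge0.
Qed.

(** * Double counting of exchanges *)

(** The pair [(j, K)] is encoded by [J = j |: K], a [p]-set avoiding [i], together with its marked
    element [j]. *)
Lemma sum_exchange_out (R : realType) (n p : nat) (i : 'I_n)
    (F : 'I_n -> {set 'I_n} -> R) :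
  (0 < p)%N ->
  \sum_(j | j != i)
    \sum_(K : {set 'I_n} | (K \subset ~: [set i; j]) && (#|K| == p - 1)%N) F j K
  = \sum_(J in psets n p | i \notin J) \sum_(j in J) F j (J :\ j).
Proof.
move=> p_gt0; rewrite (exchange_big_dep (fun j => j != i)) /=; last first.
  by move=> J j /andP[_ iJ] jJ; apply: contraNneq iJ => <-.
apply: eq_bigr => j ji.
rewrite (reindex_onto (fun J => J :\ j) (fun K => j |: K)) /=; last first.
  move=> K /andP[/subsetP sK _]; apply: setU1K; apply/negP => /sK.
  by rewrite !inE eqxx orbT.
apply: eq_bigl => J; rewrite inE.
have [jJ|jJ] := boolP (j \in J); last first.
  rewrite andbF; apply/negP => /andP[_ /eqP JE].
  by move: jJ; rewrite -JE setU11.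
rewrite setD1K // eqxx !andbT (cardsD1 j J) jJ add1n.
have -> : (#|J :\ j|.+1 == p)%N = (#|J :\ j| == p - 1)%N.
  by rewrite -[in LHS](prednK p_gt0) eqSS subn1.
rewrite andbC; congr (_ && _).
apply/subsetP/idP => [sJ|iJ l].
  by apply/negP => iJ; have := sJ i; rewrite !inE eq_sym ji iJ eqxx /= => /(_ isT).
rewrite !inE negb_or => /andP[-> lJ]; rewrite andbT.
by apply: contraNneq iJ => <-.
Qed.

(** The same pairs are encoded by [I = i |: K], a [p]-set containing [i], and a point [j] outside
    it. Combined with [sum_exchange_out], this carries sums over sets avoiding [i] to sums over sets
    containing [i]. *)
Lemma sum_exchange_in (R : realType) (n p : nat) (i : 'I_n)
    (F : 'I_n -> {set 'I_n} -> R) :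
  (0 < p)%N ->
  \sum_(j | j != i)
    \sum_(K : {set 'I_n} | (K \subset ~: [set i; j]) && (#|K| == p - 1)%N) F j K
  = \sum_(I in psets n p | i \in I) \sum_(j in ~: I) F j (I :\ i).
Proof.
move=> p_gt0; rewrite [RHS](exchange_big_dep (fun j => j != i)) /=; last first.
  by move=> I j /andP[_ iI]; rewrite inE; apply: contraNneq => ->.
apply: eq_bigr => j ji.
rewrite (reindex_onto (fun I => I :\ i) (fun K => i |: K)) /=; last first.
  move=> K /andP[/subsetP sK _]; apply: setU1K; apply/negP => /sK.
  by rewrite !inE eqxx.
apply: eq_bigl => I; rewrite !inE.
have [iI|iI] := boolP (i \in I); last first.
  rewrite !andbF; apply/negP => /andP[_ /eqP IE].
  by move: iI; rewrite -IE setU11.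
rewrite setD1K // eqxx !andbT (cardsD1 i I) iI add1n.
have -> : (#|I :\ i|.+1 == p)%N = (#|I :\ i| == p - 1)%N.
  by rewrite -[in LHS](prednK p_gt0) eqSS subn1.
rewrite andbC; congr (_ && _).
apply/subsetP/idP => [sI|jI l].
  by apply/negP => jI; have := sI j; rewrite !inE ji jI eqxx orbT /= => /(_ isT).
rewrite !inE negb_or => /andP[-> lI] /=.
by apply: contraNneq jI => <-.
Qed.

Lemma sum_Ssum_mul (R : realType) (n p : nat) (kappa t : 'rV[R]_n) :
  \sum_j Ssum p kappa j * t 0 j
  = \sum_(I in psets n p) (lambda kappa I)^-1 * \sum_(j in I) t 0 j.
Proof.
under eq_bigr do rewrite mulr_suml.
rewrite (exchange_big_dep (mem (psets n p))) /=; last by move=> j I _ /andP[].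
by apply: eq_bigr => I Ip; rewrite mulr_sumr; apply: eq_bigl => j; rewrite Ip.
Qed.

(** Moved to the sets [I] containing [i], the first inverse is that of [lambda kappa I], and the
    [t 0 j] outside [I] sum to the total minus the sum over [I]. The totals produce the right
    side. *)
Lemma Ssum_mul_sum (R : realType) (n p : nat) (kappa t : 'rV[R]_n) (i : 'I_n) :
  (0 < p)%N -> \sum_j Ssum p kappa j * t 0 j = 0 ->
  \sum_(J in psets n p | i \notin J) \sum_(j in J)
      ((lambda kappa (i |: J :\ j))^-1 - (lambda kappa J)^-1) * t 0 j
  = Ssum p kappa i * \sum_j t 0 j.
Proof.
move=> p_gt0 St0.
under eq_bigr do under eq_bigr do rewrite mulrBl.
under eq_bigr do rewrite sumrB -mulr_sumr.
rewrite sumrB.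
rewrite -(sum_exchange_out i (fun j K => (lambda kappa (i |: K))^-1 * t 0 j)) //.
rewrite sum_exchange_in //.
have -> : \sum_(I in psets n p | i \in I) \sum_(j in ~: I)
    (lambda kappa (i |: I :\ i))^-1 * t 0 j
  = \sum_(I in psets n p | i \in I) ((lambda kappa I)^-1 * \sum_j t 0 j
      - (lambda kappa I)^-1 * \sum_(j in I) t 0 j).
  apply: eq_bigr => I /andP[_ iI]; rewrite setD1K // -mulr_sumr -mulrBr.
  rewrite (bigID (mem I) predT) /= addrC addrK.
  by congr (_ * _); apply: eq_bigl => j; rewrite inE.
rewrite sumrB -mulr_suml -/(Ssum p kappa i) -addrA -opprD.
(* The subtracted sums over sets containing and avoiding [i] merge into one over all [p]-sets, which
   the constraint annihilates. *)
rewrite -(bigID (fun I : {set 'I_n} => i \in I) (mem (psets n p))) /=.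
by rewrite -sum_Ssum_mul St0 subr0.
Qed.

Lemma lambda_swap (R : realType) (n : nat) (kappa : 'rV[R]_n) (i j : 'I_n)
    (J : {set 'I_n}) :
  i \notin J -> j \in J ->
  lambda kappa (i |: J :\ j) = lambda kappa J - kappa 0 j + kappa 0 i.
Proof.
move=> iJ jJ; rewrite /lambda big_setU1 /=; last by rewrite !inE (negbTE iJ) andbF.
by rewrite [in RHS](big_setD1 j jJ) /= addrC [_ + \sum_(_ in _) _]addrC addrK.
Qed.

Lemma psets_swap (n p : nat) (i j : 'I_n) (J : {set 'I_n}) :
  J \in psets n p -> i \notin J -> j \in J -> i |: J :\ j \in psets n p.
Proof.
rewrite !inE => /eqP <- iJ jJ.
by rewrite cardsU1 !inE (negbTE iJ) andbF /= add1n (cardsD1 j J) jJ.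
Qed.

Lemma Ssum_ge0 (R : realType) (n p : nat) (kappa : 'rV[R]_n) (i : 'I_n) :
  pcone p kappa -> 0 <= Ssum p kappa i.
Proof.
by move=> kP; apply: sumr_ge0 => I /andP[/kP lI _]; rewrite invr_ge0 ltW.
Qed.

(** * Summation over all exchanges *)

(** Indexed by [I] containing [i], each summand becomes [(kappa 0 j + c) / lambda kappa I], as
    [kappa 0 i] cancels. Over the [n - p] indices outside [I] the numerators add up to [Hsum kappa -
    lambda kappa I + (n - p)%:R * c], and [lambda kappa I] is positive. *)
Lemma exchange_cost_le (R : realType) (n p : nat) (kappa : 'rV[R]_n) (i : 'I_n) :
  (0 < p)%N -> pcone p kappa ->
  \sum_(J in psets n p | i \notin J) \sum_(j in J)
     (lambda kappa J / lambda kappa (i |: J :\ j) - 1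
        + (kappa 0 i + `|kappa 0 i|) / lambda kappa (i |: J :\ j))
  <= Ssum p kappa i * (Hsum kappa + (n - p)%:R * `|kappa 0 i|).
Proof.
move=> p_gt0 kP; set c := `|_|.
(* Writing [J] as [j |: J :\ j] makes the summand a function of [j] and [K = J :\ j], as the
   exchange lemmas require. *)
under eq_bigr do under eq_bigr => j jJ do rewrite -{1}(setD1K jJ).
rewrite -(sum_exchange_out i (fun j K => lambda kappa (j |: K) / lambda kappa (i |: K) - 1
        + (kappa 0 i + c) / lambda kappa (i |: K))) // sum_exchange_in //.
rewrite /Ssum mulr_suml; apply: ler_sum => I /andP[Ip iI].
have lI := kP _ Ip; rewrite setD1K //.
have -> : \sum_(j in ~: I) (lambda kappa (j |: I :\ i) / lambda kappa I - 1
    + (kappa 0 i + c) / lambda kappa I)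
  = (lambda kappa I)^-1 * \sum_(j in ~: I) (kappa 0 j + c).
  rewrite mulr_sumr; apply: eq_bigr => j; rewrite inE => jI.
  by rewrite lambda_swap //; field; rewrite gt_eqF.
have cardC : #|~: I| = (n - p)%N.
  by rewrite cardsCs setCK card_ord; move: Ip; rewrite inE => /eqP ->.
rewrite ler_pM2l ?invr_gt0 // big_split /= sumr_const cardC -[c *+ _]mulr_natl lerD2r.
rewrite /Hsum [leRHS](bigID (mem I)) /= -/(lambda kappa I).
by under eq_bigl do rewrite inE; rewrite lerDr ltW.
Qed.

(** The bounds for single sets are added up. Keeping [mu] free allows both the optimal choice and
    [mu = 0] later. *)
Lemma Qform_ge_linear (R : realType) (n p : nat) (kappa t : 'rV[R]_n) (i : 'I_n)
    (mu : R) :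
  (2 <= p)%N -> pcone p kappa -> \sum_j Ssum p kappa j * t 0 j = 0 ->
  2 * mu * (Ssum p kappa i * \sum_j t 0 j)
    - mu ^+ 2 / 2 * (Ssum p kappa i * (Hsum kappa + (n - p)%:R * `|kappa 0 i|))
  <= Qform p kappa i t.
Proof.
move=> p2 kP St0; have p_gt0 : (0 < p)%N by apply: leq_trans p2.
have := exchange_cost_le i p_gt0 kP; set C := \sum_(J in _ | _) _ => leC.
apply: (@le_trans _ _ (2 * mu * (Ssum p kappa i * \sum_j t 0 j) - mu ^+ 2 / 2 * C)).
  by rewrite lerD2l lerN2 ler_wpM2l // divr_ge0 ?sqr_ge0.
rewrite -Ssum_mul_sum // /C !mulr_sumr -sumrB /Qform sum_exchange_out //.
rewrite [X in _ <= _ + X](bigID (fun I : {set 'I_n} => i \in I)) /= addrCA.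
apply: ler_wpDl.
  by apply: sumr_ge0 => I /andP[/kP lI _]; rewrite mulr_ge0 ?invr_ge0 ?sqr_ge0.
rewrite mulr_sumr -big_split /=; apply: ler_sum => J /andP[Jp iJ].
have cardJ : #|J| = p by move: Jp; rewrite inE => /eqP.
apply: le_trans (@exchange_quadratic_bound R _ J
  (fun j => lambda kappa (i |: J :\ j)) (fun j => t 0 j)
  (lambda kappa J) (kappa 0 i) mu _ _ _ _) _; rewrite ?cardJ //.
- exact: kP.
- by move=> j jJ; apply/kP/psets_swap.
(* Summed over [J], the [kappa 0 j] make up one copy of [lambda kappa J], whence the factor
   [p - 1]. *)
- rewrite (eq_bigr (fun j => lambda kappa J - kappa 0 j + kappa 0 i)); last first.
    by move=> j jJ; rewrite lambda_swap.
  rewrite big_split sumrB !sumr_const /= -/(lambda kappa J) cardJ.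
  rewrite -[kappa 0 i *+ _]mulr_natl -[lambda kappa J *+ _]mulr_natl.
  by ring.
rewrite lerD2r ler_pM2l //; apply: ler_sum => j jJ.
by rewrite setD1K.
Qed.

Theorem proposition5p1 (R : realType) (n p q : nat)
    (hn : (3 <= n)%N) (hp2 : (2 <= p)%N) (hpn : (p <= n - 1)%N)
    (hq : q = (n - p)%N) :
  [/\ forall (kappa : 'rV[R]_n) (i : 'I_n) (t : 'rV[R]_n),
        pcone p kappa ->
        \sum_j Ssum p kappa j * t 0 j = 0 ->
        Qform p kappa i t >=
          2 * Ssum p kappa i / (Hsum kappa + q%:R * `|kappa 0 i|)
            * (\sum_j t 0 j) ^+ 2,
      forall (theta : R) (kappa : 'rV[R]_n) (i : 'I_n) (t : 'rV[R]_n),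
        0 < theta ->
        pcone p kappa ->
        \sum_j Ssum p kappa j * t 0 j = 0 ->
        `|kappa 0 i| <= theta * Hsum kappa / q%:R ->
        Qform p kappa i t >=
          Ssum p kappa i / Hsum kappa * (2 / (1 + theta))
            * (\sum_j t 0 j) ^+ 2
    & forall (kappa : 'rV[R]_n) (i : 'I_n) (t : 'rV[R]_n),
        pcone p kappa ->
        \sum_j Ssum p kappa j * t 0 j = 0 ->
        `|kappa 0 i| <= Hsum kappa / (3 * q%:R) ->
        Qform p kappa i t >=
          3 / 2 * (Ssum p kappa i / Hsum kappa) * (\sum_j t 0 j) ^+ 2].
Proof.
have q_gt0 : 0 < q%:R :> R.
  by rewrite ltr0n hq subn_gt0 (leq_ltn_trans hpn) // subn1 prednK // (leq_trans _ hn).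
have bound (kappa : 'rV[R]_n) (i : 'I_n) (t : 'rV[R]_n) : pcone p kappa ->
    \sum_j Ssum p kappa j * t 0 j = 0 ->
    2 * Ssum p kappa i / (Hsum kappa + q%:R * `|kappa 0 i|) * (\sum_j t 0 j) ^+ 2
      <= Qform p kappa i t.
  move=> kP St0; have := Qform_ge_linear i _ hp2 kP St0; rewrite -hq.
  set D := Hsum _ + _; set T := \sum_j _ => lin.
  (* If [D = 0], the convention [0^-1 = 0] makes the claimed bound [0], which [mu = 0] gives.
     Otherwise [mu = 2 * T / D] turns the lower bound into [2 * S_i * T ^+ 2 / D]. *)
  have [D0|D0] := eqVneq D 0.
    by apply: le_trans (lin 0); rewrite D0 invr0 expr0n /= !(mulr0, mul0r) subr0.
  by apply: le_trans (lin (2 * T / D)); rewrite le_eqVlt; apply/orP; left;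
    apply/eqP; field.
have pinched (theta : R) (kappa : 'rV[R]_n) (i : 'I_n) (t : 'rV[R]_n) : 0 < theta ->
    pcone p kappa -> \sum_j Ssum p kappa j * t 0 j = 0 ->
    `|kappa 0 i| <= theta * Hsum kappa / q%:R ->
    Ssum p kappa i / Hsum kappa * (2 / (1 + theta)) * (\sum_j t 0 j) ^+ 2
      <= Qform p kappa i t.
  move=> theta0 kP St0 ki; apply: le_trans (bound _ i _ kP St0).
  rewrite ler_wpM2r ?sqr_ge0 //.
  have qki : q%:R * `|kappa 0 i| <= theta * Hsum kappa.
    by rewrite mulrC -ler_pdivlMr.
  (* The sign of [Hsum kappa] comes from the pinching hypothesis; when it is [0], the coefficient to
     be bounded is [0] by the same convention. *)
  have H_ge0 : 0 <= Hsum kappa.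
    by rewrite -(pmulr_rge0 _ theta0); apply: le_trans qki; rewrite mulr_ge0.
  have [H0|H_neq0] := eqVneq (Hsum kappa) 0.
    rewrite H0 invr0 mulr0 !mul0r add0r.
    by rewrite divr_ge0 ?mulr_ge0 ?Ssum_ge0.
  have H_gt0 : 0 < Hsum kappa by rewrite lt_neqAle eq_sym H_neq0.
  have -> : Ssum p kappa i / Hsum kappa * (2 / (1 + theta))
      = 2 * Ssum p kappa i / (Hsum kappa * (1 + theta)).
    have t1 : 1 + theta != 0 by rewrite gt_eqF //; lra.
    by field; rewrite H_neq0 t1.
  rewrite ler_wpM2l ?mulr_ge0 ?Ssum_ge0 //.
  have D_gt0 : 0 < Hsum kappa + q%:R * `|kappa 0 i|.
    by rewrite ltr_wpDr // mulr_ge0.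
  (* Pinching bounds the denominator by [Hsum kappa * (1 + theta)], and inversion reverses the
     order. *)
  rewrite lef_pV2 ?posrE ?mulr_gt0 //; last by lra.
  by rewrite mulrDr mulr1 lerD2l [leRHS]mulrC.
split=> // kappa i t kP St0 ki.
(* This is the case [theta = 3^-1]. *)
have -> : 3 / 2 = 2 / (1 + 3^-1) :> R by field.
rewrite [2 / _ * _]mulrC.
apply: pinched => //; first by rewrite invr_gt0.
by rewrite [3^-1 * _]mulrC -mulrA -invfM.
Qed.
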